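(* Let $m\ge2$. Let $\Omega$ be a body in $\mathbb{R}^m$ whose complement satisfies the uniform interior cone condition of aperture angle $\kappa$ and height $\delta$, where $0<\kappa\le\pi$ and $0<\delta\le+\infty$. For any decreasing sequence $\{h_\ell\}$ of positive numbers with zero limiting value and any illuminating centers $c(h_\ell)$ of $\Omega$ of height $h_\ell$, the distance between $c(h_\ell)$ and the set of $r^{-(m+1)}$-centers of $\Omega$ tends to zero as $\ell$ goes to $+\infty$.
   Context: A body in $\mathbb{R}^m$ is the closure of a bounded open set. $B_\rho(x)$ is the closed ball of radius $\rho$ centered at $x$, and $\sigma$ the $(m-1)$-dimensional spherical Lebesgue measure. Solid angle function: $A_\Omega(x,h)=h\int_\Omega\left(|x-\xi|^2+h^2\right)^{-(m+1)/2}d\xi$ for $x\in\mathbb{R}^m$, $h>0$. An illuminating center of $\Omega$ of height $h$ is a point of $\mathbb{R}^m$ at which $A_\Omega(\cdot,h)$ attains its maximum over $\mathbb{R}^m$. For an interior point $x$ of $\Omega$, $V_\Omega^{(-1)}(x)=\lim_{\varepsilon\to0^+}\left(\int_{\Omega\setminus B_\varepsilon(x)}|x-\xi|^{-(m+1)}d\xi-\frac{\sigma(S^{m-1})}{\varepsilon}\right)$. An $r^{-(m+1)}$-center of $\Omega$ is an interior point of $\Omega$ at which the maximum of $V_\Omega^{(-1)}$ over the interior of $\Omega$ is attained. The open cone of vertex $x$, axis direction $v\in S^{m-1}$, aperture angle $\kappa$ and height $\delta$ is $\{x+\rho w: 0<\rho<\delta,\ w\in S^{m-1},\ w\cdot v>\cos(\kappa/2)\}$.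 An open set $U$ satisfies the uniform interior cone condition of aperture angle $\kappa$ and height $\delta$ if for each $x\in U$ there is an open cone of vertex $x$, aperture angle $\kappa$ and height $\delta$ contained in $U$. *)

(* Defs.v *)
From HB Require Import structures.
From mathcomp Require Import all_boot all_order all_algebra.
From mathcomp Require Import all_classical all_reals all_analysis.
Import Order.TTheory GRing.Theory Num.Theory.
Import numFieldNormedType.Exports.

Set Implicit Arguments.
Unset Strict Implicit.
Unset Printing Implicit Defensive.

Local Open Scope classical_set_scope.
Local Open Scope ring_scope.

(* R^m is 'rV[R]_m.  Its library topology comes from the sup norm, hence is the
   usual one; Euclidean lengths are written explicitly with [enorm] below, as
   `|x| is the sup norm. *)

Definition measure_rV_display : measure_display -> measure_display.
Proof. exact. Qed.

(* Product sigma-algebra on row vectors, generated by the coordinate functions;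
   for R it is the Borel sigma-algebra of R^n. *)
Section measurable_rV.
Context {d} {T : sigmaRingType d} (n : nat).

Let coords : 'I_n -> 'rV[T]_n -> T := fun i x => x ord0 i.

Let rV_set0 : g_sigma_preimage coords set0.
Proof. exact: sigma_algebra0. Qed.

Let rV_setC A : g_sigma_preimage coords A -> g_sigma_preimage coords (~` A).
Proof. exact: sigma_algebraC. Qed.

Let rV_bigcup (F : _^nat) : (forall i, g_sigma_preimage coords (F i)) ->
  g_sigma_preimage coords (\bigcup_i (F i)).
Proof. exact: sigma_algebra_bigcup. Qed.

HB.instance Definition _ := @isMeasurable.Build (measure_rV_display d)
  'rV[T]_n (g_sigma_preimage coords) rV_set0 rV_setC rV_bigcup.

End measurable_rV.

Lemma measurable_coord {d} {T : sigmaRingType d} n (i : 'I_n) :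
  measurable_fun [set: 'rV[T]_n] (fun x : 'rV[T]_n => x ord0 i).
Proof.
move=> _ Y mY; rewrite setTI; apply: sub_sigma_algebra => /=.
rewrite -bigcup_seq/=; exists i => /=; first by rewrite mem_index_enum.
by exists Y => //; rewrite setTI.
Qed.

Lemma measurable_fun_rV {d1 d2} {T1 : measurableType d1}
    {T2 : measurableType d2} n (f : T1 -> 'rV[T2]_n) :
  (forall i, measurable_fun [set: T1] (fun x => f x ord0 i)) ->
  measurable_fun [set: T1] f.
Proof.
move=> mf _ A mA.
suff : g_sigma_preimage (fun i x => f x ord0 i) `<=` measurable.
  rewrite (g_sigma_preimage_comp (fun (i : 'I_n) (x : 'rV[T2]_n) => x ord0 i) f).
  by apply; exists A.
apply: smallest_sub; first exact: sigma_algebra_measurable.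
case: n => [|n] in f mf A mA *; first by rewrite big_ord0.
rewrite -bigcup_mkord_ord; apply: bigcup_sub => i Ii.
by move=> B [C mC <-]; exact: mf.
Qed.

Section lebesgue_rV.
Context {R : realType}.

Definition rV_cons n (p : R * 'rV[R]_n) : 'rV[R]_n.+1 :=
  \row_i (if unlift ord0 i is Some j then p.2 ord0 j else p.1).

Definition rV_uncons n (v : 'rV[R]_n.+1) : R * 'rV[R]_n :=
  (v ord0 ord0, \row_j v ord0 (lift ord0 j)).

Lemma rV_consK n : cancel (@rV_cons n) (@rV_uncons n).
Proof.
case=> x v; rewrite /rV_uncons mxE unlift_none; congr pair.
by apply/rowP => j; rewrite !mxE liftK.
Qed.

Lemma measurable_rV_cons n : measurable_fun [set: R * 'rV[R]_n] (@rV_cons n).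
Proof.
apply: measurable_fun_rV => i; under eq_fun do rewrite mxE.
case: (unlift ord0 i) => [j|]; last exact: measurable_fst.
exact: (measurableT_comp (measurable_coord j) measurable_snd).
Qed.

Lemma measurable_rV_uncons n :
  measurable_fun [set: 'rV[R]_n.+1] (@rV_uncons n).
Proof.
apply: measurable_fun_pair; first exact: measurable_coord.
apply: measurable_fun_rV => j; under eq_fun do rewrite mxE.
exact: measurable_coord.
Qed.

Section step.
Variables (n : nat) (mu : {sigma_finite_measure set 'rV[R]_n -> \bar R}).

Definition lebesgue_rVS : set 'rV[R]_n.+1 -> \bar R :=
  pushforward (lebesgue_measure \x mu)%E (@rV_cons n).

HB.instance Definition _ := Measure.copy lebesgue_rVS
  (measure_function_pushforward__canonical__measure_function_Measure
    (lebesgue_measure \x mu)%E (@measurable_rV_cons n)).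

Let lebesgue_rVS_sigma_finite : sigma_finite setT lebesgue_rVS.
Proof.
have /sigma_finiteP[F [FT ndF mF]] :=
  sigma_finiteT (@lebesgue_measure R).
have /sigma_finiteP[G [GT ndG mG]] := sigma_finiteT mu.
exists (fun k => @rV_uncons n @^-1` (F k `*` G k)).
  apply/esym/seteqP; split=> // v _; have : [set: R] (rV_uncons v).1 by [].
  have : [set: 'rV[R]_n] (rV_uncons v).2 by [].
  rewrite {1}FT GT => -[j _ Gj] [i _ Fi]; exists (maxn i j) => //; split.
    by apply: (subsetPset _ _ (ndF _ _ (leq_maxl i j))).
  by apply: (subsetPset _ _ (ndG _ _ (leq_maxr i j))).
move=> k; have [mFk Fk] := mF k; have [mGk Gk] := mG k; split.
  rewrite -[X in measurable X]setTI.
  by apply: measurable_rV_uncons => //; exact: measurableX.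
rewrite /lebesgue_rVS /pushforward -comp_preimage.
rewrite (_ : _ \o _ = id) ?preimage_id.
  by rewrite product_measure1E// lte_mul_pinfty// ge0_fin_numE.
by apply/funext => p /=; rewrite rV_consK.
Qed.

HB.instance Definition _ := Measure_isSigmaFinite.Build _ _ _
  lebesgue_rVS lebesgue_rVS_sigma_finite.

End step.

(* m-dimensional Lebesgue measure: the unit mass on R^0, then
   lambda_(n+1) = lambda_1 x lambda_n along R x R^n = R^(n+1). *)
Fixpoint lebesgue_rV n : {sigma_finite_measure set 'rV[R]_n -> \bar R} :=
  if n is n'.+1 then lebesgue_rVS (lebesgue_rV n')
  else \d_(0 : 'rV[R]_0).

End lebesgue_rV.

Section euclidean.
Context {R : realType} {m : nat}.
Implicit Types (x y u v w : 'rV[R]_m) (A E : set 'rV[R]_m).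

Definition edot u v : R := \sum_(i < m) u ord0 i * v ord0 i.

Definition enorm x : R := Num.sqrt (edot x x).

Definition eclosed_ball x (r : R) : set 'rV[R]_m := [set y | enorm (x - y) <= r].

Definition esphere : set 'rV[R]_m := [set w | enorm w = 1].

(* Spherical Lebesgue measure of E, a subset of the unit sphere: polar
   coordinates give lambda {t w | 0 < t <= 1, w in E} = sigma(E) / m. *)
Definition esphere_measure E : \bar R :=
  let cone := [set t *: w | t in [set t : R | 0 < t <= 1] & w in E] in
  ((m%:R)%:E * lebesgue_rV m cone)%E.

(* +oo when A is empty *)
Definition edist_set x A : \bar R :=
  ereal_inf [set (enorm (x - y))%:E | y in A].

Definition open_cone x v (kappa : R) (delta : \bar R) : set 'rV[R]_m :=
  [set x + rho *: w | rho in [set rho : R | 0 < rho /\ (rho%:E < delta)%E]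
                    & w in [set w | esphere w /\ cos (kappa / 2) < edot w v]].

Definition uniform_interior_cone (kappa : R) (delta : \bar R)
    (U : set 'rV[R]_m) : Prop :=
  forall x, U x ->
    exists2 v, esphere v & open_cone x v kappa delta `<=` U.

End euclidean.

Section centers.
Context {R : realType} {m : nat}.
Implicit Types (Omega : set 'rV[R]_m) (x c : 'rV[R]_m).

(* Bodies are nonempty, so that they have centers. *)
Definition body Omega : Prop :=
  exists U : set 'rV[R]_m,
    [/\ open U, bounded_set U, U !=set0 & Omega = closure U].

Definition solid_angle Omega x (h : R) : R :=
  h * \int[lebesgue_rV m]_(xi in Omega)
        (enorm (x - xi) ^+ 2 + h ^+ 2) `^ (- (m.+1%:R / 2)).

Definition illuminating_center Omega (h : R) c : Prop :=
  forall x, solid_angle Omega x h <= solid_angle Omega c h.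

Definition renormalized_potential Omega x (eps : R) : R :=
  (\int[lebesgue_rV m]_(xi in Omega `\` eclosed_ball x eps)
     (enorm (x - xi) ^- m.+1))
  - fine (esphere_measure (@esphere R m)) / eps.

(* The limit exists for x in the interior of Omega; elsewhere the value of [lim]
   is irrelevant, as [r_centers] only looks at interior points. *)
Definition V_minus1 Omega x : R :=
  lim (renormalized_potential Omega x eps @[eps --> 0^'+]).

Definition r_centers Omega : set 'rV[R]_m :=
  [set c | Omega° c /\
           forall x, Omega° x -> V_minus1 Omega x <= V_minus1 Omega c].

End centers.

(* Main.v *)
Require Import Defs.
From HB Require Import structures.
From mathcomp Require Import all_boot all_order all_algebra.
From mathcomp Require Import all_classical all_reals all_analysis measurable_realfun.
From mathcomp Require Import zify ring lra.
Import Order.TTheory GRing.Theory Num.Theory.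
Import numFieldNormedType.Exports.
Local Open Scope classical_set_scope.
Local Open Scope ring_scope.

(** Write [k h] for the kernel [(|x - xi|^2 + h^2) ^ (- (m + 1) / 2)], and let
    [F h x] be the integral of [k h] over the complement of [Omega]. The integral
    of [k h] over the whole space is finite and, by translation invariance, does
    not depend on [x]. Hence an illuminating center of height [h], which
    maximizes the integral over [Omega], is a minimizer of [F h]
    ([illuminating_center_min]).

    On the other hand, the exterior of a ball of radius [eps] has potential
    exactly [sigma / eps] at height [0] ([potential_exterior]). So for an
    interior point [x] the renormalized potential does not depend on small
    [eps], and [V_minus1 Omega x = - F 0 x] ([V_minus1E]): the centers for the
    exponent [- (m + 1)] are the minimizers of [F 0] over the interior.

    As [h] decreases to [0], [F h] increases to [F 0]. The illuminating centers
    stay bounded ([illuminating_centers_bounded]), and an accumulation point [p]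
    of them satisfies [F h p <= F 0 x] for every height [h] of the sequence and
    every interior point [x]; this uses a Harnack inequality for [F h]
    ([potential_harnack]). The cone condition makes [F h z] tend to infinity
    with [1 / h] at every point [z] of the closure of the complement
    ([potential_closure_cone]), so [p] is interior, and letting [h] tend to [0]
    gives [F 0 p <= F 0 x] ([cluster_r_center]). All accumulation points being
    centers, compactness gives the theorem.

    The measure theory reduces to one fact, the behaviour of Lebesgue measure
    under dilations and translations ([lebesgue_rV_affine]). It gives the volume
    of balls up to the volume [w] of the unit ball, the area [m w] of the sphere
    and, by a squeeze on thin shells, the potential of exteriors of balls. *)

(** * Euclidean geometry of row vectors *)

Section euclid.
Context {R : realType} {m : nat}.
Implicit Types (x y z u v : 'rV[R]_m) (r t : R).

Lemma edotC x y : edot x y = edot y x.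
Proof. by apply: eq_bigr => i _; rewrite mulrC. Qed.

Lemma edotDl x y z : edot (x + y) z = edot x z + edot y z.
Proof. by rewrite /edot -big_split; apply: eq_bigr => i _; rewrite mxE mulrDl. Qed.

Lemma edotZl t x y : edot (t *: x) y = t * edot x y.
Proof. by rewrite /edot mulr_sumr; apply: eq_bigr => i _; rewrite mxE mulrA. Qed.

Lemma edotDr x y z : edot z (x + y) = edot z x + edot z y.
Proof. by rewrite edotC edotDl !(edotC _ z). Qed.

Lemma edotZr t x y : edot y (t *: x) = t * edot y x.
Proof. by rewrite edotC edotZl edotC. Qed.

Lemma edotxx_ge0 x : 0 <= edot x x.
Proof. by apply: sumr_ge0 => i _; rewrite -expr2 sqr_ge0. Qed.

Lemma enorm_ge0 x : 0 <= enorm x.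
Proof. exact: sqrtr_ge0. Qed.

Lemma sqr_enorm x : enorm x ^+ 2 = edot x x.
Proof. by rewrite sqr_sqrtr// edotxx_ge0. Qed.

Lemma sqr_coord_le_edot x i : x ord0 i ^+ 2 <= edot x x.
Proof.
rewrite /edot (bigD1 i)//= -expr2 lerDl; apply: sumr_ge0 => j _.
by rewrite -expr2 sqr_ge0.
Qed.

Lemma enorm_eq0 x : enorm x = 0 -> x = 0.
Proof.
move=> x0; apply/rowP => i; rewrite mxE; apply/eqP.
rewrite -sqrf_eq0 eq_le sqr_ge0 andbT.
by rewrite (le_trans (sqr_coord_le_edot x i))// -sqr_enorm x0 expr0n.
Qed.

Lemma enorm0 : enorm (0 : 'rV[R]_m) = 0.
Proof. by rewrite /enorm /edot big1 ?sqrtr0// => i _; rewrite mxE mul0r. Qed.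

Lemma enormZ t x : enorm (t *: x) = `|t| * enorm x.
Proof.
by rewrite /enorm edotZl edotZr mulrA -expr2 sqrtrM ?sqr_ge0// sqrtr_sqr.
Qed.

Lemma enormN x : enorm (- x) = enorm x.
Proof. by rewrite -scaleN1r enormZ normrN1 mul1r. Qed.

Lemma enormBC x y : enorm (x - y) = enorm (y - x).
Proof. by rewrite -enormN opprB. Qed.

(** Cauchy-Schwarz: the square of the norm of [b x - a y], where [a] and [b]
    are the norms of [x] and [y], expands to [2 a b (a b - x.y)]. *)
Lemma edot_le_enorm x y : edot x y <= enorm x * enorm y.
Proof.
have [/enorm_eq0 ->|x0] := eqVneq (enorm x) 0.
  by rewrite enorm0 mul0r -(scale0r 0) edotZl mul0r.
have [/enorm_eq0 ->|y0] := eqVneq (enorm y) 0.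
  by rewrite enorm0 mulr0 -(scale0r 0) edotZr mul0r.
have := edotxx_ge0 (enorm y *: x + - enorm x *: y).
rewrite edotDl !edotDr !edotZl !edotZr (edotC y x) -!sqr_enorm => le0.
have ab0 : 0 < enorm x * enorm y by rewrite mulr_gt0// lt0r ?x0 ?y0 enorm_ge0.
rewrite -(ler_pM2l ab0); nra.
Qed.

Lemma enormD x y : enorm (x + y) <= enorm x + enorm y.
Proof.
rewrite -(ler_pXn2r (n := 2))// ?nnegrE ?addr_ge0 ?enorm_ge0//.
rewrite sqr_enorm edotDl !edotDr (edotC y x) sqrrD !sqr_enorm.
have := edot_le_enorm x y; lra.
Qed.

Lemma enorm_triangle y x z : enorm (x - z) <= enorm (x - y) + enorm (y - z).
Proof. by rewrite (le_trans _ (enormD _ _))// addrA subrK. Qed.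

Lemma normr_le_enorm x : `|x| <= enorm x.
Proof.
rewrite [leLHS]/Num.norm/= mx_normrE; apply/bigmax_leP; split=> [|[i j] _ /=].
  exact: enorm_ge0.
rewrite (ord1 i) -sqrtr_sqr; apply: ler_wsqrtr; exact: sqr_coord_le_edot.
Qed.

Lemma coord_le_normr x i : `|x ord0 i| <= `|x|.
Proof.
rewrite [leRHS]/Num.norm/= mx_normrE.
by apply/bigmax_geP; right; exists (ord0, i).
Qed.

Lemma enorm_le_normr x : enorm x <= m.+1%:R * `|x|.
Proof.
rewrite -(ler_pXn2r (n := 2))// ?nnegrE ?mulr_ge0 ?enorm_ge0//.
rewrite sqr_enorm exprMn (@le_trans _ _ (m%:R * `|x| ^+ 2))//.
  rewrite mulr_natl -[X in _ *+ X](card_ord m) -sumr_const.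
  apply: ler_sum => i _; rewrite -expr2 -real_normK ?num_real//.
  by rewrite lerXn2r ?nnegrE// coord_le_normr.
apply: ler_wpM2r; first exact: exprn_ge0.
by rewrite -natrX ler_nat; lia.
Qed.

(** The topology of row vectors comes from the sup norm; this rephrases its
    neighbourhoods in Euclidean terms. *)
Lemma nbhs_eclosed_ball x (A : set 'rV[R]_m) :
  nbhs x A <-> exists2 r, 0 < r & eclosed_ball x r `<=` A.
Proof.
split=> [/nbhs_ballP[e /= e0 xA]|[r r0 rA]].
  exists (e / 2); first exact: divr_gt0.
  move=> y xy; apply: xA; rewrite -ball_normE/=.
  rewrite (le_lt_trans (normr_le_enorm _))// (le_lt_trans xy)//.
  by rewrite ltr_pdivrMr// ltr_pMr// ltr1n.
apply/nbhs_ballP; exists (r / m.+1%:R) => /=; first exact: divr_gt0.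
move=> y; rewrite -ball_normE/= => xy; apply: rA.
rewrite /eclosed_ball/= (le_trans (enorm_le_normr _))//.
by rewrite mulrC -ler_pdivlMr// ltW.
Qed.

End euclid.

(** * Lebesgue measure under translations and dilations *)

Section change_of_variables.
Local Open Scope ereal_scope.
Context {d} {T : measurableType d} {R : realType}.
Variables (mu : {measure set T -> \bar R}) (phi : T -> T) (k : {nonneg R}).
Hypothesis mphi : measurable_fun [set: T] phi.
Hypothesis muE : forall A, measurable A ->
  mu A = k%:num%:E * mu (phi @^-1` A).

Lemma ge0_integral_change_of_variables (D : set T) (f : T -> \bar R) :
  measurable D -> measurable_fun D f -> (forall y, D y -> 0 <= f y) ->
  \int[mu]_(y in D) f y = k%:num%:E * \int[mu]_(y in phi @^-1` D) f (phi y).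
Proof.
move=> mD mf f0.
pose nu := measure_function_pushforward__canonical__measure_function_Measure
  mu mphi.
rewrite (eq_measure_integral (mscale k nu)) => [|A mA _]; last exact: muE.
rewrite ge0_integral_mscale//; congr (_ * _).
by rewrite ge0_integral_pushforward// => y; rewrite inE; exact: f0.
Qed.

End change_of_variables.

Section affine.
Context {R : realType}.
Implicit Types (t : R).

Lemma lebesgue_measure_affine (x t : R) (A : set R) : 0 < t -> measurable A ->
  lebesgue_measure A = (t%:E * lebesgue_measure ((fun y => (x + t * y)%R) @^-1` A))%E.
Proof.
move=> t0 mA; set phi := fun y => (x + t * y)%R.
have mphi : @measurable_fun _ _ (measurableTypeR R) (measurableTypeR R) setT phi.
  by apply: measurable_funD => //; exact: measurable_funM.
pose nu := measure_function_pushforward__canonical__measure_function_Measure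
  lebesgue_measure mphi.
apply: (@lebesgue_measure_unique R (mscale (NngNum (ltW t0)) nu)) => //.
move=> _ [[a b] _ <-] /=.
rewrite /mscale/= /nu/= /pushforward/=.
rewrite [X in (_ * lebesgue_measure X)%E](_ : _ =
    `](t^-1 * (a - x)), (t^-1 * (b - x))]%classic); last first.
  apply/seteqP; split=> y /=; rewrite !in_itv/= /phi.
    move=> /andP[ay yb]; rewrite ltr_pdivrMl// ler_pdivlMl//.
    by rewrite ltrBlDl ay lerBrDl yb.
  rewrite ltr_pdivrMl// ler_pdivlMl// => /andP[ay yb].
  by rewrite -ltrBlDl ay -lerBrDl yb.
rewrite !lebesgue_measure_itv/= !lte_fin ltr_pM2l ?invr_gt0// ltrD2r.
case: ifPn => _; last by rewrite mule0.
by rewrite -!EFinD -EFinM; congr EFin; field; lra.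
Qed.

Lemma measurable_affine_rV m (x : 'rV[R]_m) t :
  measurable_fun [set: 'rV[R]_m] (fun y => x + t *: y).
Proof.
apply: measurable_fun_rV => i; under eq_fun do rewrite !mxE.
by apply: measurable_funD => //; apply: measurable_funM => //; exact: measurable_coord.
Qed.

(** Slicing along the first coordinate splits the factor [t ^+ m.+1] into [t],
    from the line of first coordinates, and [t ^+ m], from the slices. *)
Lemma lebesgue_rV_affine m (x : 'rV[R]_m) t (A : set 'rV[R]_m) :
  0 < t -> measurable A ->
  lebesgue_rV m A
  = ((t ^+ m)%:E * lebesgue_rV m ((fun y => (x + t *: y)%R) @^-1` A))%E.
Proof.
move=> t0; elim: m x A => [|m IH] x A mA.
  rewrite expr0 mul1e; congr (lebesgue_rV _ _); apply/seteqP.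
  by split=> y /=; rewrite (thinmx0 y) (thinmx0 (_ + _)).
pose x' : 'rV[R]_m := \row_j x ord0 (lift ord0 j).
pose B := @rV_cons R m @^-1` A.
pose B' := @rV_cons R m @^-1` ((fun y => x + t *: y) @^-1` A).
have mB : measurable B.
  by rewrite -[B]setTI; apply: measurable_rV_cons.
have mB' : measurable B'.
  rewrite -[B']setTI; apply: measurable_rV_cons => //.
  by rewrite -[X in measurable X]setTI; apply: measurable_affine_rV.
have consE a y : rV_cons (x ord0 ord0 + t * a, x' + t *: y)
    = x + t *: rV_cons (a, y) :> 'rV[R]_m.+1.
  by apply/rowP => i; rewrite !mxE; case: unliftP => [j|] -> //=; rewrite !mxE.
have BE a : (fun y => x' + t *: y) @^-1` xsection B (x ord0 ord0 + t * a)
    = xsection B' a.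
  by apply/seteqP; split=> y; rewrite /xsection/= !inE /B /B' /= consE.
rewrite /= /lebesgue_rVS /pushforward /product_measure1 -/B -/B'.
rewrite (ge0_integral_change_of_variables _
  (fun a : measurableTypeR R => x ord0 ord0 + t * a) (NngNum (ltW t0)))//=; last 3 first.
- by apply: measurable_funD => //; exact: measurable_funM.
- by move=> C mC; exact: lebesgue_measure_affine.
- exact: measurable_fun_xsection.
rewrite exprS EFinM -muleA; congr (_ * _)%E.
rewrite preimage_setT -ge0_integralZl//=.
- apply: eq_integral => a _ /=.
  by rewrite (IH x') ?BE//; exact: measurable_xsection.
- exact: measurable_fun_xsection.
- by rewrite lee_fin exprn_ge0// ltW.
Qed.

Lemma ge0_integral_affine m (x : 'rV[R]_m) t (D : set 'rV[R]_m)
    (f : 'rV[R]_m -> \bar R) : 0 < t ->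
  measurable D -> measurable_fun D f -> (forall y, D y -> (0 <= f y)%E) ->
  (\int[lebesgue_rV m]_(y in D) f y = (t ^+ m)%:E *
   \int[lebesgue_rV m]_(y in (fun y => (x + t *: y)%R) @^-1` D)
     f (x + t *: y)%R)%E.
Proof.
move=> t0 mD mf f0.
apply: (ge0_integral_change_of_variables _ _
  (NngNum (exprn_ge0 m (ltW t0)))) => //.
  exact: measurable_affine_rV.
by move=> A mA; exact: lebesgue_rV_affine.
Qed.

End affine.

(** * Borel sets and the volume of balls *)

Section volume.
Context {R : realType} {m : nat}.
Implicit Types (x y : 'rV[R]_m) (r : R) (A : set 'rV[R]_m).

(** The product sigma-algebra contains the open sets because they are
    countable unions of cubes with rational centers. *)
Lemma open_measurable_rV A : open A -> measurable A.
Proof.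
move=> oA.
pose cube (p : 'rV[rat]_m * nat) : set 'rV[R]_m := \bigcap_(i in [set: 'I_m])
  (fun y : 'rV[R]_m => y ord0 i) @^-1` ball (ratr (p.1 ord0 i) : R) p.2.+1%:R^-1.
have mcube p : measurable (cube p).
  apply: fin_bigcap_measurable => // i _.
  rewrite -[X in measurable X]setTI.
  by apply: measurable_coord => //; exact: measurable_ball.
pose F p := if `[< cube p `<=` A >] then cube p else set0.
have mF p : measurable (F p).
  by rewrite /F; case: ifP => _; [exact: mcube|exact: measurable0].
suff -> : A = \bigcup_p F p.
  by apply: countable_bigcupT_measurable => //; exact: countableP.
apply/seteqP; split=> [x Ax|x [p _]]; last by rewrite /F; case: asboolP => // pA /pA.
have /nbhs_ballP[e /= e0 xA] : nbhs x A by exact: open_nbhs_nbhs.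
have [k ke] : exists k : nat, k.+1%:R^-1 < e / 2.
  have [k _ /(_ _ (leqnn k))] := near_infty_natSinv_lt (PosNum (divr_gt0 e0 (ltr0n R 2))).
  by exists k.
have k0 : 0 < k.+1%:R^-1 :> R by rewrite invr_gt0.
have qP i : exists q : rat, ball (x ord0 i) k.+1%:R^-1 (ratr q : R).
  have /rat_in_itvoo[q] : x ord0 i - k.+1%:R^-1 < x ord0 i + k.+1%:R^-1.
    by rewrite ltrBlDr -addrA ltrDl addr_gt0.
  by rewrite -[X in X -> _]/(`]_, _[%classic _) -ball_itv => xq; exists q.
pose q : 'rV[rat]_m := \row_i sval (cid (qP i)).
have xq i : ball (x ord0 i) k.+1%:R^-1 (ratr (q ord0 i) : R).
  by rewrite mxE; case: cid.
exists (q, k) => //; rewrite /F; case: asboolP => [_|[]].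
  by move=> i _ /=; exact: ball_sym.
move=> y qy; apply: xA; split=> // i j; rewrite (ord1 i).
apply: (@le_ball _ _ _ (k.+1%:R^-1 + k.+1%:R^-1)).
  by rewrite (splitr e) lerD// ltW.
exact: ball_triangle (xq j) (qy j I).
Qed.

Lemma closed_measurable_rV A : closed A -> measurable A.
Proof.
move=> cA; rewrite -[A]setCK; apply: measurableC.
by apply: open_measurable_rV; exact: closed_openC.
Qed.

Lemma measurable_enormB x :
  measurable_fun [set: 'rV[R]_m] (fun y => enorm (x - y)).
Proof.
apply: (@measurableT_comp _ _ _ _ _ _ (@Num.sqrt R)).
  by apply: continuous_measurable_fun; exact: sqrt_continuous.
apply: measurable_sum => i; under eq_fun do rewrite !mxE.
by apply: measurable_funM; apply: measurable_funB => //; exact: measurable_coord.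
Qed.

Lemma measurable_eclosed_ball x r : measurable (eclosed_ball x r).
Proof.
rewrite -[X in measurable X]setTI.
by apply: measurable_fun_le => //; exact: measurable_enormB.
Qed.

End volume.

Section ball_volume.
Context {R : realType}.
Implicit Types (r a : R).

Lemma measurable_cube m a :
  measurable [set y : 'rV[R]_m | forall i, `|y ord0 i| <= a].
Proof.
rewrite (_ : [set _ | _] = \bigcap_(i in [set: 'I_m])
    ((fun y : 'rV[R]_m => y ord0 i) @^-1` `[- a, a]%classic)).
  apply: fin_bigcap_measurable => // i _; rewrite -[X in measurable X]setTI.
  exact: measurable_coord.
apply/seteqP; split=> y /= ya i.
  by move=> _ /=; rewrite in_itv/= -ler_norml.
by have := ya i I; rewrite /= in_itv/= -ler_norml.
Qed.

Lemma lebesgue_rV_cube m a : 0 <= a ->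
  lebesgue_rV m [set y : 'rV[R]_m | forall i, `|y ord0 i| <= a]
  = ((a *+ 2) ^+ m)%:E.
Proof.
move=> a0; elim: m => [|m IH].
  by rewrite expr0 /= diracE mem_set// => -[].
rewrite /= /lebesgue_rVS /pushforward.
rewrite [X in product_measure1 _ _ X](_ : _ = `[- a, a]%classic `*`
    [set y : 'rV[R]_m | forall i, `|y ord0 i| <= a]); last first.
  apply/seteqP; split=> -[b y] /=; rewrite in_itv/= -ler_norml.
    move=> H; split; first by have := H ord0; rewrite mxE unlift_none.
    by move=> i; have := H (lift ord0 i); rewrite mxE liftK.
  move=> [ba ya] i; rewrite mxE.
  by case: unliftP => [j|] _ //=; exact: ya.
rewrite product_measure1E//; last exact: measurable_cube.
rewrite IH exprS EFinM; congr (_ * _)%E.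
transitivity (lebesgue_measure `[- a, a]%classic); first by [].
rewrite lebesgue_measure_itv/= lte_fin.
case: ifPn => [_|]; first by rewrite -EFinB opprK.
by rewrite -leNgt => aa; rewrite (_ : a = 0) ?mul0rn//; lra.
Qed.

Definition unit_ball_volume m : R := fine (lebesgue_rV m (eclosed_ball 0 1)).

Lemma unit_ball_volumeE m :
  lebesgue_rV m (eclosed_ball 0 1) = (unit_ball_volume m)%:E.
Proof.
rewrite fineK// ge0_fin_numE//.
apply: (@le_lt_trans _ _
  (lebesgue_rV m [set y : 'rV[R]_m | forall i, `|y ord0 i| <= 1])).
  apply: le_measure; rewrite ?inE.
  - exact: measurable_eclosed_ball.
  - exact: measurable_cube.
  - move=> y; rewrite /eclosed_ball/= enormBC subr0 => y1 i.
    by rewrite (le_trans (coord_le_normr _ _))// (le_trans (normr_le_enorm _)).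
by rewrite lebesgue_rV_cube// ltry.
Qed.

Lemma unit_ball_volume_gt0 m : 0 < unit_ball_volume m.
Proof.
rewrite -lte_fin -unit_ball_volumeE.
pose a : R := m.+1%:R^-1.
have a0 : 0 < a by rewrite invr_gt0.
apply: (@lt_le_trans _ _
  (lebesgue_rV m [set y : 'rV[R]_m | forall i, `|y ord0 i| <= a])).
  by rewrite lebesgue_rV_cube ?ltW// lte_fin exprn_gt0// mulrn_wgt0.
apply: le_measure; rewrite ?inE.
- exact: measurable_cube.
- exact: measurable_eclosed_ball.
- move=> y /= ya; rewrite /eclosed_ball/= enormBC subr0.
  rewrite (le_trans (enorm_le_normr _))// mulrC -ler_pdivlMr// mul1r.
  rewrite /Num.norm/= mx_normrE; apply/bigmax_leP; split; first exact: ltW.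
  by move=> [i j] _ /=; rewrite (ord1 i).
Qed.

Lemma lebesgue_eclosed_ball m (x : 'rV[R]_m) r : 0 < r ->
  lebesgue_rV m (eclosed_ball x r) = (r ^+ m * unit_ball_volume m)%:E.
Proof.
move=> r0; rewrite (lebesgue_rV_affine _ x _ _ r0); last exact: measurable_eclosed_ball.
rewrite EFinM -unit_ball_volumeE; congr (_ * lebesgue_rV _ _)%E.
apply/seteqP; split=> y; rewrite /eclosed_ball/= opprD addrA subrr !sub0r !enormN enormZ
  gtr0_norm//.
  by rewrite -ler_pdivlMl// mulVf// gt_eqF.
by move=> y1; rewrite ger_pMr.
Qed.

Lemma lebesgue_rV_set1 m (x : 'rV[R]_m) : (0 < m)%N ->
  lebesgue_rV m [set x] = 0%E.
Proof.
move=> m0; apply/eqP; rewrite eq_le measure_ge0 andbT.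
apply/lee_addgt0Pr => e e0; rewrite add0e.
pose r := Num.min 1 (e / unit_ball_volume m).
have r0 : 0 < r by rewrite lt_min ltr01 divr_gt0// unit_ball_volume_gt0.
apply: (@le_trans _ _ (lebesgue_rV m (eclosed_ball x r))).
  apply: le_measure; rewrite ?inE.
  - by apply: closed_measurable_rV; exact/accessible_closed_set1/hausdorff_accessible/norm_hausdorff.
  - exact: measurable_eclosed_ball.
  - by move=> _ ->; rewrite /eclosed_ball/= subrr enorm0 ltW.
rewrite lebesgue_eclosed_ball// lee_fin -ler_pdivlMr ?unit_ball_volume_gt0//.
rewrite (@le_trans _ _ r)//; last by rewrite ge_min lexx orbT.
have r1 : r <= 1 by rewrite /r ge_min lexx.
by rewrite -[leRHS]expr1 ler_wiXn2l// ltW.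
Qed.

(** The cone over the sphere is the punctured unit ball. *)
Lemma esphere_measureE m : (0 < m)%N ->
  esphere_measure (@esphere R m) = (m%:R * unit_ball_volume m)%:E.
Proof.
move=> m0; rewrite /esphere_measure EFinM; congr (_ * _)%E.
rewrite (_ : [set _ | _ in _ & _ in _] = eclosed_ball 0 1 `\` [set 0]).
  pose B : set 'rV[R]_m := eclosed_ball 0 1.
  pose Z : set 'rV[R]_m := [set 0].
  have -> : lebesgue_rV m (B `\` Z)
      = (lebesgue_rV m B - lebesgue_rV m (B `&` Z))%E.
    apply: measureD.
    - exact: measurable_eclosed_ball.
    - apply: closed_measurable_rV.
      exact/accessible_closed_set1/hausdorff_accessible/norm_hausdorff.
    - by rewrite [ltLHS]unit_ball_volumeE ltry.
  rewrite /B /Z unit_ball_volumeE setIC setIidl ?lebesgue_rV_set1// ?sube0// => _ ->.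
  by rewrite /eclosed_ball/= subrr enorm0.
apply/seteqP; split=> [_ [t /= /andP[t0 t1] [w w1 <-]]|y [/=]].
  split; first by rewrite /eclosed_ball/= sub0r enormN enormZ w1 mulr1 gtr0_norm.
  move=> /= tw; have : enorm (t *: w) = 0 by rewrite tw enorm0.
  by rewrite enormZ w1 mulr1 gtr0_norm// => t00; rewrite t00 ltxx in t0.
rewrite /eclosed_ball/= sub0r enormN => y1 y0.
have n0 : 0 < enorm y.
  by rewrite lt0r enorm_ge0 andbT; apply/eqP => /enorm_eq0.
exists (enorm y) => /=; first by rewrite n0.
exists ((enorm y)^-1 *: y).
  by rewrite /esphere/= enormZ gtr0_norm ?invr_gt0// mulVf// gt_eqF.
by rewrite scalerA mulfV ?scale1r// gt_eqF.
Qed.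

End ball_volume.

(** * The potential of a region seen from a given height *)

(** The distance in dimension [m + 1] from the point at height [h] above [x]
    to the point [xi] of the base. *)
Definition slant {R : realType} {m : nat} (h : R) (x xi : 'rV[R]_m) : R :=
  Num.sqrt (enorm (x - xi) ^+ 2 + h ^+ 2).

(** For [h > 0], [h] times this integral is the solid angle function of [D]; for
    [h = 0] it is the potential of the kernel of exponent [- (m + 1)]. *)
HB.lock Definition potential {R : realType} {m : nat} (h : R)
    (D : set 'rV[R]_m) (x : 'rV[R]_m) : \bar R :=
  (\int[lebesgue_rV m]_(xi in D) (slant h x xi ^- m.+1)%:E)%E.

Section potential.
Context {R : realType} {m : nat}.
Implicit Types (x y z xi : 'rV[R]_m) (h r : R) (D : set 'rV[R]_m).

Lemma slant_ge0 h x xi : 0 <= slant h x xi.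
Proof. exact: sqrtr_ge0. Qed.

Lemma sqr_slant h x xi : slant h x xi ^+ 2 = enorm (x - xi) ^+ 2 + h ^+ 2.
Proof. by rewrite sqr_sqrtr// addr_ge0// sqr_ge0. Qed.

Lemma slant0 x xi : slant 0 x xi = enorm (x - xi).
Proof. by rewrite /slant expr0n addr0 sqrtr_sqr ger0_norm// enorm_ge0. Qed.

Lemma powR_slant h x xi :
  (enorm (x - xi) ^+ 2 + h ^+ 2) `^ (- (m.+1%:R / 2)) = slant h x xi ^- m.+1.
Proof.
have s0 : 0 <= enorm (x - xi) ^+ 2 + h ^+ 2 by rewrite addr_ge0// sqr_ge0.
by rewrite -mulNr mulrC powRrM powR12_sqrt// powR_invn// sqrtr_ge0.
Qed.

Lemma le_height_slant h x xi : 0 <= h -> h <= slant h x xi.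
Proof.
by move=> h0; rewrite -[leLHS]ger0_norm// -sqrtr_sqr ler_wsqrtr// lerDr sqr_ge0.
Qed.

Lemma le_enorm_slant h x xi : enorm (x - xi) <= slant h x xi.
Proof.
rewrite -[leLHS]ger0_norm ?enorm_ge0// -sqrtr_sqr ler_wsqrtr//.
by rewrite lerDl sqr_ge0.
Qed.

Lemma le_slant h h' x xi : 0 <= h -> h <= h' -> slant h x xi <= slant h' x xi.
Proof.
move=> h0 hh'; rewrite ler_wsqrtr// lerD2l lerXn2r// nnegrE//.
exact: le_trans hh'.
Qed.

Lemma slant_leD h x xi : 0 <= h -> slant h x xi <= enorm (x - xi) + h.
Proof.
move=> h0; have n0 := enorm_ge0 (x - xi).
rewrite -(ler_pXn2r (n := 2))// ?nnegrE ?addr_ge0 ?slant_ge0//.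
by rewrite sqr_slant sqrrD lerD2r lerDl mulrn_wge0// mulr_ge0.
Qed.

Lemma slant_triangle h x y xi :
  slant h x xi <= slant h y xi + enorm (x - y).
Proof.
have d0 := enorm_ge0 (x - y); have n0 := enorm_ge0 (y - xi).
rewrite -(ler_pXn2r (n := 2))// ?nnegrE ?addr_ge0 ?slant_ge0//.
rewrite sqrrD !sqr_slant.
have le1 : enorm (x - xi) ^+ 2 <= (enorm (x - y) + enorm (y - xi)) ^+ 2.
  by rewrite lerXn2r ?nnegrE ?addr_ge0 ?enorm_ge0// enorm_triangle.
have := ler_wpM2l d0 (le_enorm_slant h y xi).
rewrite sqrrD in le1; lra.
Qed.

Lemma measurable_slant h x D :
  measurable_fun D (fun xi => (slant h x xi ^- m.+1)%:E).
Proof.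
under eq_fun do rewrite -powR_slant.
apply/measurable_EFinP; apply: measurable_funTS.
apply: (@measurableT_comp _ _ _ _ _ _ (@powR R ^~ (- (m.+1%:R / 2)))).
  exact: measurable_powR.
apply: measurable_funD => //; apply: measurable_funX; exact: measurable_enormB.
Qed.

Lemma slantX_ge0 h x xi : (0 <= (slant h x xi ^- m.+1)%:E)%E.
Proof. by rewrite lee_fin invr_ge0 exprn_ge0// slant_ge0. Qed.

Lemma potential_ge0 h D x : (0 <= potential h D x)%E.
Proof. by rewrite potential.unlock; apply: integral_ge0 => xi _; exact: slantX_ge0. Qed.

Lemma potentialU h D D' x : measurable D -> measurable D' ->
  [disjoint D & D'] ->
  potential h (D `|` D') x = (potential h D x + potential h D' x)%E.
Proof.
move=> mD mD' DD'; rewrite potential.unlock; apply: ge0_integral_setU => //.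
  exact: measurable_slant.
by move=> xi _; exact: slantX_ge0.
Qed.

Lemma le_potential_subset h D D' x : measurable D -> measurable D' ->
  D `<=` D' -> (potential h D x <= potential h D' x)%E.
Proof.
move=> mD mD' DD'; rewrite potential.unlock; apply: ge0_subset_integral => //.
  exact: measurable_slant.
by move=> xi _; exact: slantX_ge0.
Qed.

Lemma potential_le h D x a : measurable D -> 0 < a ->
  (forall xi, D xi -> a <= slant h x xi) ->
  (potential h D x <= (a ^- m.+1)%:E * lebesgue_rV m D)%E.
Proof.
move=> mD a0 Da; rewrite potential.unlock -integral_cst//; apply: ge0_le_integral => //.
- by move=> xi _; exact: slantX_ge0.
- exact: measurable_slant.
- move=> xi /Da axi; rewrite lee_fin lef_pV2 ?posrE ?exprn_gt0//.
    by rewrite lerXn2r// nnegrE ?slant_ge0// ltW.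
  exact: lt_le_trans axi.
Qed.

(** The kernels at two heights and vertices are compared pointwise; this one
    estimate yields the monotonicity in [h] and the Harnack inequality below. *)
Lemma potential_le_scale h h' D x y C : measurable D -> 0 <= C ->
  (forall xi, D xi -> 0 < slant h' y xi <= C * slant h x xi) ->
  (potential h D x <= (C ^+ m.+1)%:E * potential h' D y)%E.
Proof.
move=> mD C0 DC; rewrite potential.unlock -ge0_integralZl//; first last.
- by rewrite lee_fin exprn_ge0.
- by move=> xi _; exact: slantX_ge0.
- exact: measurable_slant.
apply: ge0_le_integral => //.
- by move=> xi _; exact: slantX_ge0.
- exact: measurable_slant.
- by apply: measurable_funeM; exact: measurable_slant.
move=> xi /DC /andP[s0 sC]; rewrite lee_fin.
have S0 : 0 < slant h x xi.
  rewrite lt0r slant_ge0 andbT; apply/eqP => S0.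
  by move: sC; rewrite S0 mulr0 leNgt s0.
rewrite ler_pdivlMr ?exprn_gt0// mulrC ler_pdivrMr ?exprn_gt0//.
by rewrite -exprMn lerXn2r// nnegrE ?mulr_ge0// ltW.
Qed.

Lemma potential_ge h D x b : measurable D -> 0 <= b ->
  (forall xi, D xi -> 0 < slant h x xi <= b) ->
  ((b ^- m.+1)%:E * lebesgue_rV m D <= potential h D x)%E.
Proof.
move=> mD b0 Db; rewrite potential.unlock -integral_cst//; apply: ge0_le_integral => //.
- by move=> xi _; rewrite lee_fin invr_ge0 exprn_ge0.
- exact: measurable_slant.
- move=> xi /Db /andP[s0 sb]; rewrite lee_fin lef_pV2 ?posrE ?exprn_gt0//.
    by rewrite lerXn2r// nnegrE ?slant_ge0.
  exact: lt_le_trans sb.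
Qed.

(** Translation invariance of Lebesgue measure. *)
Lemma potentialT h x : potential h setT x = potential h setT (0 : 'rV[R]_m).
Proof.
rewrite potential.unlock (ge0_integral_affine _ x 1 setT)//; last 2 first.
- exact: measurable_slant.
- by move=> xi _; exact: slantX_ge0.
rewrite expr1n mul1e preimage_setT; apply: eq_integral => xi _.
by rewrite /slant scale1r opprD addrA subrr.
Qed.

(** The kernel is homogeneous of degree [- (m + 1)] and the volume of degree
    [m]. *)
Lemma potential0_scale D x r : 0 < r -> measurable D ->
  potential 0 D x
  = ((r^-1)%:E *
     potential 0 ((fun y => x + r *: y)%R @^-1` D) (0 : 'rV[R]_m)%R)%E.
Proof.
move=> r0 mD; rewrite potential.unlock [LHS](ge0_integral_affine _ x r D
  (fun xi => (slant 0 x xi ^- m.+1)%:E) r0 mD); last 2 first.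
- exact: measurable_slant.
- by move=> xi _; exact: slantX_ge0.
have mD' : measurable ((fun y => x + r *: y) @^-1` D).
  by rewrite -[X in measurable X]setTI; apply: measurable_affine_rV.
have -> : (r^-1)%:E = ((r ^+ m)%:E * (r ^- m.+1)%:E)%E.
  by rewrite -EFinM exprS invfM mulrCA mulfV ?mulr1// expf_neq0// gt_eqF.
rewrite -muleA; congr (_ * _)%E.
rewrite -ge0_integralZl//.
- apply: eq_integral => xi _; rewrite -EFinM; congr EFin.
  by rewrite !slant0 opprD addrA subrr !sub0r !enormN enormZ gtr0_norm// exprMn invfM.
- exact: measurable_slant.
- by move=> xi _; exact: slantX_ge0.
- by rewrite lee_fin invr_ge0 exprn_ge0// ltW.
Qed.

End potential.

(** * The potential of the exterior of a ball *)

Section limit_lemma.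
Context {R : realType}.

(** Inequalities holding up to a factor [q ^+ n], for all [q > 1], are sharp. *)
Lemma le_mulX_gt1 (a b : R) n :
  (forall q, 1 < q -> a <= b * q ^+ n) -> a <= b.
Proof.
move=> ab.
have qb : (b * q ^+ n) @[q --> 1^'+] --> b * 1 ^+ n.
  apply: cvgMr; apply: cvg_at_right_filter; exact: exprn_continuous.
rewrite -[b]mulr1 -(expr1n R n).
apply: (cvgr_to_ge qb).
by near=> q; apply: ab; near: q; exact: nbhs_right_gt.
Unshelve. all: by end_near. Qed.

End limit_lemma.

Section exterior.
Context {R : realType} (m : nat).
Local Notation w := (unit_ball_volume m : R).
Local Notation B r := (eclosed_ball (0 : 'rV[R]_m) r).
Local Notation P D := (potential 0 D (0 : 'rV[R]_m)).

Lemma measurable_eclosed_ballC (x : 'rV[R]_m) r :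
  measurable (~` eclosed_ball x r).
Proof. by apply: measurableC; exact: measurable_eclosed_ball. Qed.

Lemma measurable_shell r r' : measurable (B r' `\` B r).
Proof. by apply: measurableD; exact: measurable_eclosed_ball. Qed.

Lemma eclosed_ball0E r y : B r y = (enorm y <= r).
Proof. by rewrite /eclosed_ball/= sub0r enormN. Qed.

Lemma le_eclosed_ball (x : 'rV[R]_m) r r' : r <= r' ->
  eclosed_ball x r `<=` eclosed_ball x r'.
Proof. by move=> rr' y /le_trans; apply. Qed.

Lemma lebesgue_shell q : 1 < q ->
  lebesgue_rV m (B q `\` B 1) = (w * (q ^+ m - 1))%:E.
Proof.
move=> q1; have q0 : 0 < q by exact: lt_trans q1.
have -> : lebesgue_rV m (B q `\` B 1)
    = (lebesgue_rV m (B q) - lebesgue_rV m (B q `&` B 1))%E.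
  apply: measureD; [exact: measurable_eclosed_ball..|].
  by rewrite [ltLHS]lebesgue_eclosed_ball// ltry.
rewrite setIidr; last by apply: le_eclosed_ball; exact: ltW.
rewrite !lebesgue_eclosed_ball// -EFinB; congr EFin.
by rewrite expr1n; ring.
Qed.

Lemma preimage_dilation_ball q r : 0 < q ->
  (fun y : 'rV[R]_m => 0 + q *: y) @^-1` B (q * r) = B r.
Proof.
move=> q0; apply/seteqP; split=> y /=;
  by rewrite !eclosed_ball0E add0r enormZ gtr0_norm// ler_pM2l.
Qed.

Lemma exterior_split q r : 1 <= q -> q <= r ->
  P (B r `\` B 1) = (P (B q `\` B 1) + P (B r `\` B q))%E.
Proof.
move=> q1 qr; rewrite -potentialU; [|exact: measurable_shell..|].
  congr potential; apply/seteqP; split=> y /=; rewrite !eclosed_ball0E.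
    by move=> [yr y1]; have [yq|yq] := leP (enorm y) q; [left|right];
      split=> //; apply/negP; rewrite -ltNge.
  move=> [[yq y1]|[yr yq]]; first by split=> //; exact: le_trans yq _.
  by split=> // /le_trans/(_ q1).
rewrite disj_set2E; apply/eqP/seteqP; split=> // y /=.
by rewrite !eclosed_ball0E => -[[yq _] [_]].
Qed.

Lemma potential_shell_le q : 1 < q ->
  (P (B q `\` B 1) <= (w * (q ^+ m - 1))%:E)%E.
Proof.
move=> q1; rewrite -lebesgue_shell// -[leRHS]mul1e.
have -> : (1 = (1 ^- m.+1)%:E :> \bar R)%E by rewrite expr1n invr1.
apply: potential_le => //; first exact: measurable_shell.
by move=> y /= [_]; rewrite eclosed_ball0E slant0 sub0r enormN => /negP;
  rewrite -ltNge => /ltW.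
Qed.

Lemma potential_shell_ge q : 1 < q ->
  ((q ^- m.+1 * (w * (q ^+ m - 1)))%:E <= P (B q `\` B 1))%E.
Proof.
move=> q1; rewrite EFinM -lebesgue_shell//.
apply: potential_ge => //; first exact: measurable_shell.
  by rewrite ltW// (lt_trans _ q1).
move=> y /=; rewrite !eclosed_ball0E slant0 sub0r enormN => -[-> /negP].
by rewrite -ltNge andbT; exact: lt_trans.
Qed.

(** Dilating by [2] halves the potential, so the dyadic shells contribute a
    geometric series of ratio [1 / 2], uniformly bounded by twice its first
    term. *)
Lemma potential_dyadic_le n :
  (P (B (2 ^+ n) `\` B 1) <= (2 * (w * (2 ^+ m - 1)))%:E)%E.
Proof.
have w0 : 0 <= w * (2 ^+ m - 1).
  rewrite mulr_ge0 ?subr_ge0 ?exprn_ege1 ?ler1n//.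
  exact/ltW/unit_ball_volume_gt0.
elim: n => [|n IH].
  rewrite expr0 setDv potential.unlock integral_set0 lee_fin mulr_ge0//.
rewrite (@exterior_split 2); last 2 first.
- by rewrite ler1n.
- by rewrite exprS ler_peMr// exprn_ege1// ler1n.
rewrite [X in (_ + X)%E](potential0_scale _ _ 2)//; last exact: measurable_shell.
have -> : (fun y : 'rV[R]_m => 0 + 2 *: y) @^-1` (B (2 ^+ n.+1) `\` B 2)
    = B (2 ^+ n) `\` B 1.
  have -> : B 2 = B (2 * 1) by rewrite mulr1.
  rewrite -(preimage_dilation_ball 2 (2 ^+ n)) ?ltr0n//.
  by rewrite -(preimage_dilation_ball 2 1) ?ltr0n// exprS.
apply: (@le_trans _ _ ((w * (2 ^+ m - 1))%:E +
    (2^-1)%:E * (2 * (w * (2 ^+ m - 1)))%:E)%E).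
  apply: leeD; first by apply: potential_shell_le; rewrite ltr1n.
  by apply: lee_wpmul2l.
by rewrite -EFinM -EFinD lee_fin; lra.
Qed.

Lemma bigcup_exterior : ~` B 1 = \bigcup_n (B (2 ^+ n) `\` B 1).
Proof.
apply/seteqP; split=> [y y1|y [n _ []]//].
exists (Num.bound (enorm y)) => //; split=> //.
rewrite eclosed_ball0E (le_trans (ltW (archi_boundP (enorm_ge0 y))))//.
by rewrite -natrX ler_nat ltnW// ltn_expl.
Qed.

Lemma potential_exterior_lty : (P (~` B 1) < +oo)%E.
Proof.
apply: (@le_lt_trans _ _ (2 * (w * (2 ^+ m - 1)))%:E); last exact: ltry.
rewrite bigcup_exterior.
have shells : P (B (2 ^+ n) `\` B 1) @[n --> \oo]
    --> P (\bigcup_n (B (2 ^+ n) `\` B 1)).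
  rewrite potential.unlock; apply: ge0_nondecreasing_set_cvg_integral.
  - move=> i j ij; apply/subsetPset => y [yi y1]; split=> //.
    apply: le_eclosed_ball yi.
    by rewrite ler_weXn2l// ler1n.
  - by move=> i; exact: measurable_shell.
  - by move=> i; exact: measurable_slant.
  - by move=> i xi _; exact: slantX_ge0.
rewrite -(cvg_lim _ shells)//; apply: lime_le; first exact: cvgP shells.
by apply: nearW => n; exact: potential_dyadic_le.
Qed.

Lemma preimage_affine_ballC (x : 'rV[R]_m) r : 0 < r ->
  (fun y : 'rV[R]_m => x + r *: y) @^-1` (~` eclosed_ball x r) = ~` B 1.
Proof.
move=> r0; apply/seteqP; split=> y; apply: contra_not;
  by rewrite eclosed_ball0E /eclosed_ball/= opprD addrA subrr sub0r enormN
    enormZ gtr0_norm// ger_pMr.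
Qed.

(** Let [t] be this potential. Dilating by [q > 1] shows that the shell between
    radii [1] and [q] has potential [t (1 - 1 / q)]; on that shell the kernel
    lies between [q ^- m.+1] and [1]. Dividing by the thickness of the shell and
    letting [q] tend to [1] leaves [m w] as the only possible value of [t]. *)
Lemma potential_exterior1 : P (~` B 1) = (m%:R * w)%:E.
Proof.
have Pfin : P (~` B 1) \is a fin_num.
  by rewrite ge0_fin_numE ?potential_exterior_lty// potential_ge0.
have w0 := unit_ball_volume_gt0 m : 0 < w.
set t := fine (P (~` B 1)).
have tE : P (~` B 1) = t%:E by rewrite fineK.
have t0 : 0 <= t by rewrite fine_ge0// potential_ge0.
have shellE q : 1 < q ->
    P (B q `\` B 1) = (t * (1 - q^-1))%:E.
  move=> q1; have q0 : 0 < q by exact: lt_trans q1.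
  have : P (~` B 1) = (P (B q `\` B 1) + P (~` B q))%E.
    rewrite -potentialU; [|exact: measurable_shell|exact: measurable_eclosed_ballC|].
      congr potential; apply/seteqP; split=> y /=; rewrite !eclosed_ball0E.
        by move=> y1; have [yq|yq] := leP (enorm y) q; [left|right] => //;
          apply/negP; rewrite -ltNge.
      move=> [[]//|yq y1]; apply: yq; apply: (le_trans y1); exact: ltW.
    rewrite disj_set2E; apply/eqP/seteqP; split=> // y /=.
    by rewrite !eclosed_ball0E => -[[yq _]].
  rewrite [X in (_ + X)%E](potential0_scale _ _ q)//; last exact: measurable_eclosed_ballC.
  rewrite preimage_affine_ballC// tE.
  case: (P _) (potential_ge0 0 (B q `\` B 1) 0) => [p| |]//= _.
  by rewrite -EFinM -EFinD => -[tp]; congr EFin; lra.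
have geo q : q ^+ m - 1 = (q - 1) * \sum_(i < m) q ^+ i by exact: subrX1.
rewrite tE; congr EFin; apply/eqP; rewrite eq_le; apply/andP; split.
  apply: (@le_mulX_gt1 _ _ _ m.+1) => q q1.
  have q0 : 0 < q by exact: lt_trans q1.
  have := potential_shell_le _ q1; rewrite shellE// lee_fin geo.
  have -> : t * (1 - q^-1) = (q - 1) * (t / q) by field; rewrite gt_eqF.
  rewrite [leRHS]mulrCA ler_pM2l ?subr_gt0// ler_pdivrMr// => /le_trans; apply.
  rewrite exprSr mulrA ler_pM2r// [leLHS]mulrC [leRHS]mulrAC ler_pM2r//.
  rewrite mulr_natl -[X in _ *+ X](card_ord m) -sumr_const.
  by apply: ler_sum => i _; rewrite ler_weXn2l ?(ltW q1)// ltnW.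
apply: (@le_mulX_gt1 _ _ _ m.+1) => q q1.
have q0 : 0 < q by exact: lt_trans q1.
have := potential_shell_ge _ q1; rewrite shellE// lee_fin geo.
rewrite ler_pdivrMl ?exprn_gt0// [leLHS]mulrCA.
have -> : q ^+ m.+1 * (t * (1 - q^-1)) = (q - 1) * (t * q ^+ m).
  by rewrite exprS; field; rewrite gt_eqF.
rewrite ler_pM2l ?subr_gt0// => wt.
apply: (@le_trans _ _ (t * q ^+ m)); last first.
  by rewrite ler_wpM2l// ler_weXn2l ?(ltW q1)// leqnSn.
rewrite mulrC; apply: le_trans wt; rewrite ler_pM2l//.
rewrite -[X in X%:R](card_ord m) -sumr_const.
by apply: ler_sum => i _; rewrite exprn_ege1// (ltW q1).
Qed.

(** This is the divergent term that [V_minus1] subtracts: the area of the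
    sphere, [m w], divided by the radius. *)
Lemma potential_exterior (x : 'rV[R]_m) r : 0 < r ->
  potential 0 (~` eclosed_ball x r) x = (m%:R * w / r)%:E.
Proof.
move=> r0; rewrite (potential0_scale _ _ r)//; last exact: measurable_eclosed_ballC.
rewrite preimage_affine_ballC//.
by rewrite potential_exterior1 -EFinM mulrC.
Qed.

End exterior.

(** * Potentials of the complement of a body *)

Section complement.
Context {R : realType} {m : nat}.
Implicit Types (x y z c : 'rV[R]_m) (h r : R) (D Omega U : set 'rV[R]_m).
Local Notation w := (unit_ball_volume m : R).

(** At height [0] the kernel has the junk value [0] at the vertex itself, hence
    the positivity hypothesis. *)
Lemma le_potential_height h h' D x : measurable D ->
  0 <= h -> h <= h' -> (forall xi, D xi -> 0 < slant h x xi) ->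
  (potential h' D x <= potential h D x)%E.
Proof.
move=> mD h0 hh' D0; rewrite -[leRHS]mul1e.
have -> : (1 = (1 ^+ m.+1)%:E :> \bar R)%E by rewrite expr1n.
by apply: potential_le_scale => // xi /D0 ->; rewrite mul1r le_slant.
Qed.

Lemma slant_gt0 h x xi : 0 < h -> 0 < slant h x xi.
Proof. by move=> h0; rewrite (lt_le_trans h0)// le_height_slant// ltW. Qed.

(** The slant distance is 1-Lipschitz in the vertex and at least [h], so moving
    the vertex by [d] multiplies it by at most [1 + d / h]. *)
Lemma potential_harnack h D x y : measurable D -> 0 < h ->
  (potential h D x <=
   ((1 + enorm (x - y) / h) ^+ m.+1)%:E * potential h D y)%E.
Proof.
move=> mD h0; have d0 := enorm_ge0 (x - y).
apply: potential_le_scale => //; first by rewrite addr_ge0// divr_ge0// ltW.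
move=> xi _; rewrite slant_gt0//=.
rewrite (le_trans (slant_triangle _ _ x _))// mulrDl mul1r lerD2l enormBC.
rewrite mulrAC -mulrA ler_peMr//.
by rewrite ler_pdivlMr// mul1r le_height_slant// ltW.
Qed.

(** Away from the region the kernel at height [0] is controlled by the kernel
    at height [h], because [slant h] is at most [1 + h / r] times the distance. *)
Lemma potential0_le h r D x : measurable D -> 0 < h -> 0 < r ->
  eclosed_ball x r `<=` ~` D ->
  (potential 0 D x <= ((1 + h / r) ^+ m.+1)%:E * potential h D x)%E.
Proof.
move=> mD h0 r0 xD; apply: potential_le_scale => //.
  by rewrite addr_ge0// divr_ge0// ltW.
move=> xi Dxi; rewrite slant_gt0//= slant0.
have rx : r <= enorm (x - xi).
  by rewrite leNgt; apply/negP => xr; apply: (xD xi) => //; exact: ltW.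
rewrite (le_trans (slant_leD _ _ _ (ltW h0)))// mulrDl mul1r lerD2l.
by rewrite mulrAC -mulrA ler_peMr ?(ltW h0)// ler_pdivlMr// mul1r.
Qed.

Lemma potential0_lty r D x : measurable D -> 0 < r ->
  eclosed_ball x r `<=` ~` D -> (potential 0 D x < +oo)%E.
Proof.
move=> mD r0 xD.
apply: (@le_lt_trans _ _ (potential 0 (~` eclosed_ball x r) x)).
  apply: le_potential_subset => //; first exact: measurable_eclosed_ballC.
  by rewrite -[D]setCK; apply: subsetC.
by rewrite potential_exterior// ltry.
Qed.

Lemma potentialT_lty h x : 0 < h -> (potential h setT x < +oo)%E.
Proof.
move=> h0; rewrite -(setUv (eclosed_ball x 1)) potentialU; first last.
- by rewrite disj_set2E setICr.
- exact: measurable_eclosed_ballC.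
- exact: measurable_eclosed_ball.
apply: lte_add_pinfty.
  apply: (@le_lt_trans _ _ ((h ^- m.+1)%:E *
      lebesgue_rV m (eclosed_ball x 1))%E).
    apply: potential_le => // [|xi _]; first exact: measurable_eclosed_ball.
    by apply: le_height_slant; exact: ltW.
  by rewrite lebesgue_eclosed_ball// -EFinM ltry.
apply: (@le_lt_trans _ _ (potential 0 (~` eclosed_ball x 1) x)).
  apply: le_potential_height => //; first exact: measurable_eclosed_ballC.
    exact: ltW.
  by move=> xi /negP; rewrite -ltNge slant0; exact: lt_trans.
by rewrite potential_exterior// ltry.
Qed.

Lemma potential_setC h Omega x : measurable Omega ->
  (potential h Omega x + potential h (~` Omega) x = potential h setT (0 : 'rV[R]_m)%R)%E.
Proof.
move=> mO; have mC := measurableC mO.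
have dis : [disjoint Omega & ~` Omega] by rewrite disj_set2E setICr.
by rewrite -(potentialU _ _ _ _ mO mC dis) setUv potentialT.
Qed.

Lemma solid_angleE h Omega x :
  solid_angle Omega x h = h * fine (potential h Omega x).
Proof.
rewrite /solid_angle /Rintegral potential.unlock.
by under eq_integral do rewrite powR_slant.
Qed.

Lemma potential_fin_num h D x : measurable D -> 0 < h ->
  potential h D x \is a fin_num.
Proof.
move=> mD h0; rewrite ge0_fin_numE ?potential_ge0//.
by rewrite (le_lt_trans _ (potentialT_lty _ x h0))// le_potential_subset.
Qed.

Lemma illuminating_center_max h Omega c x : measurable Omega -> 0 < h ->
  illuminating_center Omega h c ->
  (potential h Omega x <= potential h Omega c)%E.
Proof.
move=> mO h0 cO; have := cO x.
rewrite solid_angleE (solid_angleE _ _ c) (ler_pM2l h0) -lee_fin.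
rewrite fineK; last exact: potential_fin_num.
by rewrite fineK; last exact: potential_fin_num.
Qed.

(** The potentials of the body and of its complement have the same finite sum
    at every point, so maximizing one is minimizing the other. *)
Lemma illuminating_center_min h Omega c x : measurable Omega -> 0 < h ->
  illuminating_center Omega h c ->
  (potential h (~` Omega) c <= potential h (~` Omega) x)%E.
Proof.
move=> mO h0 cO; rewrite leNgt; apply/negP => xc.
have : (potential h Omega x + potential h (~` Omega) x <
        potential h Omega c + potential h (~` Omega) c)%E.
  apply: lee_ltD => //; first exact: potential_fin_num.
  exact: illuminating_center_max.
by rewrite !potential_setC// ltxx.
Qed.

(** As soon as the removed ball lies in the body, its exterior is the disjoint
    union of the domain of integration and of the complement of the body; by
    [potential_exterior] the renormalized potential is then independent of the
    radius. *)
Lemma V_minus1E r Omega x : (0 < m)%N -> measurable Omega -> 0 < r ->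
  eclosed_ball x r `<=` Omega ->
  V_minus1 Omega x = - fine (potential 0 (~` Omega) x).
Proof.
move=> m0 mO r0 xO; apply: lim_near_cst; first exact: Rhausdorff.
near=> e; have e0 : 0 < e by near: e; exact: nbhs_right_gt.
have er : e <= r by near: e; exact: nbhs_right_le.
have eO : eclosed_ball x e `<=` Omega.
  by apply: subset_trans xO; exact: le_eclosed_ball.
have Cfin : potential 0 (~` Omega) x \is a fin_num.
  rewrite ge0_fin_numE ?potential_ge0//.
  apply: (@potential0_lty r) => //; first exact: measurableC.
  by rewrite setCK.
rewrite /renormalized_potential esphere_measureE//= /Rintegral.
have -> : (\int[lebesgue_rV m]_(xi in Omega `\` eclosed_ball x e)
    (enorm (x - xi) ^- m.+1)%:E)%E = potential 0 (Omega `\` eclosed_ball x e) x.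
  by rewrite potential.unlock; apply: eq_integral => xi _; rewrite slant0.
have mOe : measurable (Omega `\` eclosed_ball x e).
  by apply: measurableD => //; exact: measurable_eclosed_ball.
have := potential_exterior _ x _ e0.
have -> : ~` eclosed_ball x e = (Omega `\` eclosed_ball x e) `|` ~` Omega.
  apply/seteqP; split=> y.
    by move=> ye; have [yO|yO] := pselect (Omega y); [left|right].
  by move=> [[]//|yO] /eO.
rewrite potentialU; first last.
- rewrite disj_set2E; apply/eqP/seteqP; split=> // y.
  by move=> -[[]].
- exact: measurableC.
- exact: mOe.
rewrite -(fineK Cfin).
case: (potential 0 (Omega `\` _) x) (potential_ge0 0 (Omega `\` eclosed_ball x e) x)
  => [p| |]//= _.
by rewrite -EFinD => -[<-]; rewrite /=; ring.
Unshelve. all: by end_near. Qed.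

End complement.

(** * Blow-up at the boundary *)

Section cone.
Context {R : realType} {m : nat}.
Implicit Types (x y z u v xi : 'rV[R]_m) (kappa rho s h r : R)
  (U : set 'rV[R]_m).
Local Notation w := (unit_ball_volume m : R).

Lemma cos_half_lt1 kappa : 0 < kappa -> kappa <= pi -> cos (kappa / 2) < 1.
Proof.
move=> k0 kpi; have pi0 := pi_gt0 R.
rewrite -[ltRHS](@cos0 R) ltr_cos ?in_itv/=; first lra.
  by apply/andP; split; lra.
by apply/andP; split; lra.
Qed.

Lemma cos_half_ge0 kappa : 0 < kappa -> kappa <= pi -> 0 <= cos (kappa / 2).
Proof.
by move=> k0 kpi; have pi0 := pi_gt0 R; apply: cos_ge0_pihalf; apply/andP; split;
  lra.
Qed.

(** Perturbing [rho v] by [u] with norm at most [s rho] keeps the inner product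
    with [v] above [(1 - s) rho] and the norm below [(1 + s) rho]; the choice of
    [s] makes their quotient larger than the cosine. *)
Lemma eclosed_ball_sub_cone kappa (delta : \bar R) s rho x v :
  0 < kappa -> kappa <= pi ->
  s = (1 - cos (kappa / 2)) / 4 -> 0 < rho -> ((2 * rho)%:E <= delta)%E ->
  esphere v ->
  eclosed_ball (x + rho *: v) (s * rho) `<=` open_cone x v kappa delta.
Proof.
move=> k0 kpi sE rho0 rhod v1 y; rewrite /eclosed_ball/= => yr.
have c1 := cos_half_lt1 _ k0 kpi; have c0 := cos_half_ge0 _ k0 kpi.
set c := cos _ in sE c1 c0.
have srho : s * rho < rho by rewrite gtr_pMl// sE; lra.
pose u := y - (x + rho *: v).
have ur : enorm u <= s * rho by rewrite /u enormBC.
have yE : y = x + (rho *: v + u) by rewrite /u addrA addrC subrK.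
pose n := enorm (rho *: v + u).
have rv : enorm (rho *: v) = rho by rewrite enormZ v1 mulr1 gtr0_norm.
have n_le : n <= rho + s * rho.
  by rewrite (le_trans (enormD _ _))// rv lerD2l.
have n_ge : rho - s * rho <= n.
  have : enorm (rho *: v) <= n + enorm u.
    by rewrite -(enormN u) (le_trans _ (enormD _ _))// addrK.
  rewrite rv; lra.
have n0 : 0 < n by apply: lt_le_trans n_ge; rewrite subr_gt0.
exists n => /=.
  by split=> //; apply: (lt_le_trans _ rhod); rewrite lte_fin; lra.
exists (n^-1 *: (rho *: v + u)); last by rewrite scalerA mulfV ?gt_eqF// scale1r.
split; first by rewrite /esphere/= enormZ gtr0_norm ?invr_gt0// -/n mulVf// gt_eqF.
rewrite -/c edotZl ltr_pdivlMl// edotDl edotZl -sqr_enorm v1 expr1n mulr1.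
have : edot (- u) v <= enorm u by rewrite -[leRHS]mulr1 -v1 -(enormN u) edot_le_enorm.
rewrite -scaleN1r edotZl => uv.
apply: (@le_lt_trans _ _ ((rho + s * rho) * c)).
  by rewrite ler_wpM2r.
apply: (@lt_le_trans _ _ (rho - s * rho)); last lra.
rewrite -subr_gt0 (_ : _ - _ = rho * ((1 - c) * (3 - c)) / 4).
  by rewrite divr_gt0// mulr_gt0// mulr_gt0// subr_gt0//; lra.
by rewrite sE; field.
Qed.

(** For every small [rho], the cone condition puts in [U] a ball of radius
    [s rho] within distance [2 rho] of [z]. At heights at most [rho] the kernel
    is at least [(4 rho) ^- m.+1] on it, so that it contributes [a / rho]. *)
Lemma potential_closure_cone kappa (delta : \bar R) U z (M : R) :
  0 < kappa -> kappa <= pi -> (0 < delta)%E -> measurable U ->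
  uniform_interior_cone kappa delta U -> closure U z ->
  exists2 h0, 0 < h0 &
    forall h, 0 < h -> h <= h0 -> (M%:E < potential h U z)%E.
Proof.
move=> k0 kpi d0 mU coneU Uz.
pose s : R := (1 - cos (kappa / 2)) / 4.
have c1 := cos_half_lt1 _ k0 kpi; have c0 := cos_half_ge0 _ k0 kpi.
have s0 : 0 < s by rewrite /s; lra.
have s1 : s <= 1 by rewrite /s; lra.
have w0 := unit_ball_volume_gt0 m : 0 < w.
have [rho0 rho0_gt0 rho0d] : exists2 rho0 : R, 0 < rho0 & ((2 * rho0)%:E <= delta)%E.
  case: delta d0 {coneU} => [r| |]// r0.
    by exists (r / 2); [rewrite divr_gt0 | rewrite lee_fin mulrC divfK].
  by exists 1 => //; rewrite leey.
pose a : R := 4 ^- m.+1 * s ^+ m * w.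
have a0 : 0 < a by rewrite !mulr_gt0// ?invr_gt0 ?exprn_gt0.
(* Below [rho0] the cones are high enough; the other bound makes [a / rho]
   exceed [M]. *)
pose rho := Num.min rho0 (a / (`|M| + 1)).
have M0 : 0 < `|M| + 1 by rewrite ltr_wpDl.
have rho_gt0 : 0 < rho by rewrite lt_min rho0_gt0 divr_gt0.
have rhod : ((2 * rho)%:E <= delta)%E.
  by apply: le_trans rho0d; rewrite lee_fin ler_pM2l// /rho ge_min lexx.
have Mrho : M < a / rho.
  rewrite (@lt_le_trans _ _ (`|M| + 1))//.
    by rewrite (le_lt_trans (ler_norm M))// ltrDl.
  by rewrite ler_pdivlMr// mulrC -ler_pdivlMr// /rho ge_min lexx orbT.
have [x [Ux zx]] : U `&` eclosed_ball z rho !=set0.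
  by apply: Uz; apply/nbhs_eclosed_ball; exists rho.
have [v v1 vU] := coneU x Ux.
pose y := x + rho *: v.
have yU : eclosed_ball y (s * rho) `<=` U.
  by apply: subset_trans vU; exact: eclosed_ball_sub_cone.
have srho_gt0 : 0 < s * rho by exact: mulr_gt0.
exists rho => // h h0 hrho.
apply: (@lt_le_trans _ _ (potential h (eclosed_ball y (s * rho)) z)); last first.
  by apply: le_potential_subset => //; exact: measurable_eclosed_ball.
pose b : R := (4 * rho) ^- m.+1.
apply: (@lt_le_trans _ _ (b%:E *
    lebesgue_rV m (eclosed_ball y (s * rho)))%E).
  rewrite lebesgue_eclosed_ball// -EFinM lte_fin.
  apply: (lt_le_trans Mrho); rewrite le_eqVlt; apply/orP; left; apply/eqP.
  rewrite /a /b !exprMn !exprS; field.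
  by rewrite !expf_neq0 gt_eqF.
apply: (potential_ge _ _ _ (4 * rho)); [exact: measurable_eclosed_ball|by rewrite mulr_ge0// ltW|].
move=> xi yxi; rewrite slant_gt0//= (le_trans (slant_leD _ _ _ (ltW h0)))//.
have := enorm_triangle x z xi; have := enorm_triangle y x xi.
have -> : enorm (x - y) = rho.
  by rewrite /y opprD addrA subrr sub0r enormN enormZ v1 mulr1 gtr0_norm.
move: zx yxi; rewrite /eclosed_ball/= => zx yxi.
have : s * rho <= rho by rewrite ger_pMl.
lra.
Qed.

End cone.

(** * Limits of illuminating centers *)

Section limits.
Context {R : realType} {m : nat}.
Implicit Types (x y z c : 'rV[R]_m) (h r : R) (D Omega U : set 'rV[R]_m).
Local Notation w := (unit_ball_volume m : R).

Lemma closed_eclosed_ball x r : closed (eclosed_ball x r).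
Proof.
rewrite -[eclosed_ball x r]setCK; apply: open_closedC.
rewrite openE => y /negP; rewrite -ltNge => rxy.
apply/nbhs_eclosed_ball; exists ((enorm (x - y) - r) / 2).
  by rewrite divr_gt0// subr_gt0.
move=> z; rewrite /eclosed_ball/= => yz; apply/negP; rewrite -ltNge.
have := enorm_triangle z x y; rewrite (enormBC z y); lra.
Qed.

(** The accumulation point is a cluster point of the filter of tails of [u]
    restricted to the indices in [P]. Keeping track of [P] lets the theorem be
    proved by contradiction, with [P] saying that a center is far from its
    expected limits. *)
Lemma bounded_cluster (u : nat -> 'rV[R]_m) (P : nat -> Prop) (M : R) :
  (forall l, enorm (u l) <= M) ->
  (forall N, exists2 l, (N <= l)%N & P l) ->
  exists p, forall e N, 0 < e ->
    exists l, [/\ (N <= l)%N, P l & enorm (p - u l) <= e].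
Proof.
move=> uM Pinf.
pose F : set_system 'rV[R]_m :=
  [set A | exists N, forall l, (N <= l)%N -> P l -> A (u l)].
have PF : ProperFilter F.
  apply: Build_ProperFilter_ex.
    by move=> A [N NA]; have [l Nl Pl] := Pinf N; exists (u l); exact: NA.
  split.
  - by exists 0%N.
  - move=> A B [N NA] [N' NB]; exists (maxn N N') => l.
    by rewrite geq_max => /andP[Nl N'l] Pl; split; [exact: NA|exact: NB].
  - by move=> A B AB [N NA]; exists N => l Nl Pl; apply/AB/NA.
have cK : compact [set v : 'rV[R]_m | forall i, `[(- M), M]%classic (v ord0 i)].
  by apply: (@rV_compact _ _ (fun=> `[(- M), M]%classic)) => _;
    exact: segment_compact.
have [|p [_ Fp]] := cK F PF.
  exists 0%N => l _ _ i /=; rewrite in_itv/= -ler_norml.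
  by rewrite (le_trans (coord_le_normr _ _))// (le_trans (normr_le_enorm _)).
exists p => e N e0.
have [] := Fp [set u l | l in [set l | (N <= l)%N /\ P l]] (eclosed_ball p e).
- by exists N => l Nl Pl; exists l.
- by apply/nbhs_eclosed_ball; exists e.
- by move=> _ [[l [Nl Pl] <-] pl]; exists l.
Qed.

Lemma body_closed Omega : body Omega -> closed Omega.
Proof. by move=> [U [_ _ _ ->]]; exact: closed_closure. Qed.

Lemma body_bounded Omega : body Omega ->
  exists2 K, 0 < K & Omega `<=` eclosed_ball 0 K.
Proof.
move=> [U [_ bU _ ->]].
have [M M0 UM] : exists2 M : R, 0 < M & forall y, U y -> `|y| <= M.
  have /= [M [_ MU]] := bU; exists (`|M| + 1); first by rewrite ltr_wpDl.
  by apply: MU; rewrite (le_lt_trans (ler_norm M))// ltrDl.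
exists (m.+1%:R * M); first by rewrite mulr_gt0.
rewrite closureE; apply: smallest_sub; first exact: closed_eclosed_ball.
move=> y /UM yM; rewrite /eclosed_ball/= sub0r enormN.
by rewrite (le_trans (enorm_le_normr _))// ler_wpM2l.
Qed.

Lemma body_interior Omega : body Omega -> exists x, Omega° x.
Proof.
move=> [U [oU _ [x Ux] ->]]; exists x.
have : U `<=` (closure U)° by rewrite -open_subsetE//; exact: subset_closure.
exact.
Qed.

(** A center sees the body at least as well as a fixed interior point does, and
    the potential at that point only grows as the height decreases; but the
    potential of the body is small far from it. *)
Lemma illuminating_centers_bounded Omega (h : nat -> R) (c : nat -> 'rV[R]_m) :
  body Omega -> nonincreasing_seq h -> (forall l, 0 < h l) ->
  (forall l, illuminating_center Omega (h l) (c l)) ->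
  exists M, forall l, enorm (c l) <= M.
Proof.
move=> bO hdec h0 cO.
have mO := closed_measurable_rV _ (body_closed _ bO).
have [K K0 OK] := body_bounded _ bO.
have [x /nbhs_eclosed_ball[r r0 xO]] := body_interior _ bO.
have w0 := unit_ball_volume_gt0 m : 0 < w.
pose a : R := (r + h 0%N) ^- m.+1 * (r ^+ m * w).
have a0 : 0 < a.
  by rewrite mulr_gt0 ?invr_gt0 ?exprn_gt0 ?addr_gt0// mulr_gt0 ?exprn_gt0.
have a_le l : (a%:E <= potential (h l) Omega (c l))%E.
  apply: (@le_trans _ _ (potential (h l) Omega x)); last first.
    exact: illuminating_center_max.
  apply: (@le_trans _ _ (potential (h 0%N) Omega x)); last first.
    apply: le_potential_height => //; [exact: ltW|exact: hdec|].
    by move=> xi _; exact: slant_gt0.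
  apply: (@le_trans _ _ (potential (h 0%N) (eclosed_ball x r) x)); last first.
    by apply: le_potential_subset => //; exact: measurable_eclosed_ball.
  have b0 : 0 <= r + h 0%N by rewrite addr_ge0// ltW.
  rewrite EFinM -(lebesgue_eclosed_ball _ x)//.
  apply: potential_ge => //; first exact: measurable_eclosed_ball.
  move=> xi xxi; rewrite slant_gt0//= (le_trans (slant_leD _ _ _ (ltW (h0 _))))//.
  by rewrite lerD2r.
pose rho := Num.max 1 (2 * (K ^+ m * w) / a).
have rho1 : 1 <= rho by rewrite le_max lexx.
have rho0 : 0 < rho by exact: lt_le_trans rho1.
exists (K + rho) => l; rewrite leNgt; apply/negP => cl.
have : (potential (h l) Omega (c l) <= (rho ^- m.+1 * (K ^+ m * w))%:E)%E.
  apply: (@le_trans _ _ (potential (h l) (eclosed_ball 0 K) (c l))).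
    by apply: le_potential_subset => //; exact: measurable_eclosed_ball.
  rewrite EFinM -(lebesgue_eclosed_ball _ 0)//.
  apply: potential_le => //; first exact: measurable_eclosed_ball.
  move=> xi; rewrite /eclosed_ball/= => xi0.
  apply: le_trans (le_enorm_slant _ _ _).
  have := enorm_triangle xi (c l) 0; rewrite subr0.
  rewrite sub0r enormN in xi0; rewrite subr0; lra.
apply/negP; rewrite -ltNge; apply: lt_le_trans (a_le l); rewrite lte_fin.
apply: (@le_lt_trans _ _ (rho^-1 * (K ^+ m * w))).
  apply: ler_wpM2r; first by rewrite ltW// mulr_gt0// exprn_gt0.
  by rewrite lef_pV2 ?posrE ?exprn_gt0// exprS ler_peMr ?exprn_ege1// ltW.
rewrite ltr_pdivrMl// -ltr_pdivrMr//.
apply: (@lt_le_trans _ _ (2 * (K ^+ m * w) / a)); last by rewrite le_max lexx orbT.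
rewrite ltr_pM2r ?invr_gt0// ltr_pMl ?ltr1n//.
by rewrite mulr_gt0 ?exprn_gt0.
Qed.

(** The condition on [d] under which the factors of [potential_harnack] and
    [potential0_le] are at most [q ^+ n]. *)
Lemma bound_1DdivX (d h q : R) n : 0 <= d -> 0 < h -> d <= h * (q - 1) ->
  0 <= (1 + d / h) ^+ n <= q ^+ n.
Proof.
move=> d0 h0 dq; have b0 : 0 <= 1 + d / h by rewrite addr_ge0// divr_ge0// ltW.
have bq : 1 + d / h <= q by rewrite -lerBrDl ler_pdivrMr// mulrC.
by rewrite exprn_ge0//= lerXn2r// nnegrE (le_trans b0).
Qed.

(** Let [F h] be the potential of the complement at height [h]; it increases as
    [h] decreases. For an interior point [x] and [k >= l],
    [F (h l) (c k) <= F (h k) (c k) <= F (h k) x <= F 0 x], and the Harnack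
    inequality passes this bound from the points [c k] to [p]. Hence
    [F (h l) p <= F 0 x] for all [l]: this excludes that [p] lies in the closure
    of the complement, where [F] blows up, and at an interior point [p] it gives
    [F 0 p <= F 0 x] as [l] grows. *)
Lemma cluster_r_center Omega kappa (delta : \bar R) (h : nat -> R)
    (c : nat -> 'rV[R]_m) p :
  (0 < m)%N -> body Omega ->
  0 < kappa -> kappa <= pi -> (0 < delta)%E ->
  uniform_interior_cone kappa delta (~` Omega) ->
  nonincreasing_seq h -> (forall l, 0 < h l) -> h l @[l --> \oo] --> (0 : R) ->
  (forall l, illuminating_center Omega (h l) (c l)) ->
  (forall e N, 0 < e -> exists2 l, (N <= l)%N & enorm (p - c l) <= e) ->
  r_centers Omega p.
Proof.
move=> m0 bO k0 kpi d0 coneO hdec h0 hto0 cO pcl.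
have mO := closed_measurable_rV _ (body_closed _ bO).
have mC := measurableC mO.
have h_small e : 0 < e -> exists l, h l <= e.
  move=> e0; have [N _ Ne] := cvgr_le 0 hto0 _ e0.
  by exists N; exact: Ne (leqnn N).
pose B x := fine (potential 0 (~` Omega) x).
have BE x r : 0 < r -> eclosed_ball x r `<=` Omega ->
    potential 0 (~` Omega) x = (B x)%:E.
  move=> r0 xO; rewrite fineK// ge0_fin_numE ?potential_ge0//.
  by apply: (@potential0_lty _ _ r); rewrite ?setCK.
have step l x r : 0 < r -> eclosed_ball x r `<=` Omega ->
    (potential (h l) (~` Omega) p <= (B x)%:E)%E.
  move=> r0 xO.
  rewrite -[leLHS]fineK ?potential_fin_num// lee_fin.
  apply: (@le_mulX_gt1 _ _ _ m.+1) => q q1.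
  have e0 : 0 < h l * (q - 1) by rewrite mulr_gt0// subr_gt0.
  have [k lk pk] := pcl _ l e0.
  rewrite -lee_fin fineK ?potential_fin_num//.
  apply: (le_trans (potential_harnack _ _ _ (c k) mC (h0 l))).
  have /andP[q0 qX] := bound_1DdivX _ _ _ m.+1 (enorm_ge0 (p - c k)) (h0 l) pk.
  rewrite [B x * _]mulrC EFinM; apply: lee_pmul; [by rewrite lee_fin|exact: potential_ge0|by rewrite lee_fin|].
  apply: (@le_trans _ _ (potential (h k) (~` Omega) (c k))).
    apply: le_potential_height => //; [exact: ltW|exact: hdec|].
    by move=> xi _; exact: slant_gt0.
  apply: (@le_trans _ _ (potential (h k) (~` Omega) x)).
    exact: illuminating_center_min.
  rewrite -(BE x r)//; apply: le_potential_height => //; first exact: ltW.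
  move=> xi Oxi; rewrite slant0 lt0r enorm_ge0 andbT; apply/eqP => xxi.
  by apply: Oxi; apply: xO; rewrite /eclosed_ball/= xxi ltW.
have [x0 /nbhs_eclosed_ball[r1 r10 x0O]] := body_interior _ bO.
have pO : Omega° p.
  apply: contrapT => pO; have pC : closure (~` Omega) p by rewrite closure_setC.
  have [e e0 eB] := potential_closure_cone _ _ _ _ (B x0) k0 kpi d0 mC coneO pC.
  have [l le] := h_small e e0.
  have := eB _ (h0 l) le; apply/negP; rewrite -leNgt.
  exact: step x0O.
split; first exact: pO.
move=> x /nbhs_eclosed_ball[r r0 xO].
have [r' r'0 pO'] := (nbhs_eclosed_ball _ _).1 pO.
apply: (@le_trans _ _ (- B x)).
  by rewrite (V_minus1E r Omega x m0 mO r0 xO).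
apply: (@le_trans _ _ (- B p)); last first.
  by rewrite (V_minus1E r' Omega p m0 mO r'0 pO').
rewrite lerN2.
apply: (@le_mulX_gt1 _ _ _ m.+1) => q q1.
have [l lr] : exists l, h l <= r' * (q - 1).
  by apply: h_small; rewrite mulr_gt0// subr_gt0.
rewrite -lee_fin -(BE p r')//.
apply: (le_trans (potential0_le _ _ _ _ mC (h0 l) r'0 _)); first by rewrite setCK.
have /andP[q0 qX] := bound_1DdivX _ _ _ m.+1 (ltW (h0 l)) r'0 lr.
rewrite [B x * _]mulrC EFinM; apply: lee_pmul; [by rewrite lee_fin|exact: potential_ge0|by rewrite lee_fin|].
exact: step xO.
Qed.

End limits.

Theorem proposition5p8 (R : realType) (m : nat) (Omega : set 'rV[R]_m)
    (kappa : R) (delta : \bar R) (h : nat -> R) (c : nat -> 'rV[R]_m) :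
  (2 <= m)%N ->
  body Omega ->
  0 < kappa -> kappa <= pi -> (0 < delta)%E ->
  uniform_interior_cone kappa delta (~` Omega) ->
  nonincreasing_seq h ->
  (forall l, 0 < h l) ->
  h l @[l --> \oo] --> (0 : R) ->
  (forall l, illuminating_center Omega (h l) (c l)) ->
  edist_set (c l) (r_centers Omega) @[l --> \oo] --> 0%E.
Proof.
move=> m2 bO k0 kpi d0 coneO hdec h0 hto0 cO.
have m0 : (0 < m)%N by exact: leq_trans m2.
have [M cM] := illuminating_centers_bounded _ _ _ bO hdec h0 cO.
have dist_ge0 l : (0 <= edist_set (c l) (r_centers Omega))%E.
  by apply: le_ereal_inf_tmp => _ [y _ <-]; rewrite lee_fin enorm_ge0.
have dist_small e : 0 < e -> exists N, forall l, (N <= l)%N ->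
    (edist_set (c l) (r_centers Omega) <= e%:E)%E.
  move=> e0; apply: contrapT => /forallNP far.
  have [|p pc] := bounded_cluster c
    (fun l => ~ (edist_set (c l) (r_centers Omega) <= e%:E)%E) M cM.
    by move=> N; have /existsNP[l /not_implyP[Nl fl]] := far N; exists l.
  have pO : r_centers Omega p.
    apply: (cluster_r_center Omega kappa delta h c) => //.
    by move=> d N /(pc d N) [l [Nl _ pl]]; exists l.
  have [l [_ + pl]] := pc e 0%N e0; apply.
  by apply: ge_ereal_inf; exists (enorm (c l - p))%:E; [exists p|
    rewrite lee_fin enormBC].
have dist_fin l N : (edist_set (c l) (r_centers Omega) <= N%:E)%E ->
    edist_set (c l) (r_centers Omega) \is a fin_num.
  by move=> cN; rewrite ge0_fin_numE// (le_lt_trans cN)// ltry.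
apply: cvg_EFin.
  by have [N cN] := dist_small 1 ltr01; exists N => // l /cN; exact: dist_fin.
apply/cvgrPdist_le => e e0; have [N cN] := dist_small e e0.
exists N => // l /cN cle; rewrite sub0r normrN ger0_norm ?fine_ge0//.
by rewrite -lee_fin fineK ?(dist_fin _ _ cle).
Qed.
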